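(* Let $d\ge1$ and let $\mathbf{V}^{(d)}$ be the $N^d\times L$ $d$-fold random Vandermonde matrix whose phase vectors are i.i.d. in $[0,1]^d$ with a continuous density $f$ satisfying $\min_{[0,1]^d} f>0$. Let $\lambda_L$ be the largest eigenvalue of $(\mathbf{V}^{(d)})^*\mathbf{V}^{(d)}$. If $N,L\to\infty$ with $L/N^d\to\beta\in(0,\infty)$, then there exists a constant $K>0$ such that $$\mathbb{P}\Big(\lambda_L\ge K\,\frac{\log N^d}{\log\log N^d}\Big)=1-o(1).$$
   Context: The $d$-fold Vandermonde matrix: given phase vectors $x_1,\ldots,x_L\in[0,1]^d$ and $N$, index the rows by $\ell\in\{0,\ldots,N-1\}^d$ via $\gamma(\ell)=\sum_{j=1}^d N^{j-1}\ell_j$, and set $\mathbf{V}^{(d)}_{(\gamma(\ell),q)}=N^{-d/2}\exp(2\pi i\langle \ell,x_q\rangle)$. *)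

(* Defs.v *)
From HB Require Import structures.
From mathcomp Require Import all_boot all_order all_algebra.
From mathcomp Require Import all_classical all_reals all_analysis.
From mathcomp Require Import complex.
Set Implicit Arguments. Unset Strict Implicit. Unset Printing Implicit Defensive.
Import Order.TTheory GRing.Theory Num.Theory.
Import numFieldNormedType.Exports.
Local Open Scope classical_set_scope.
Local Open Scope ring_scope.

Section Vandermonde.
Variable R : realType.

(* Multi-index decoding: the row r = gamma(l) = sum_{j=1}^d N^(j-1) l_j has
   (0-indexed) coordinate l_j = (r / N^j) mod N. *)
Definition mindex (N : nat) (d : nat) (r : nat) (j : 'I_d) : nat :=
  (r %/ N ^ j) %% N.

Definition vandermonde (d N L : nat) (x : 'I_L -> 'I_d -> R) : 'M[R[i]]_(N ^ d, L) :=
  \matrix_(r < N ^ d, q < L)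
    (let s := \sum_(j < d) (mindex N r j)%:R * x q j in
     ((Num.sqrt ((N%:R : R) ^+ d))^-1)%:C
       * (cos (2 * pi * s) +i* sin (2 * pi * s)))%C.

Definition adjmx m n (A : 'M[R[i]]_(m, n)) : 'M[R[i]]_(n, m) :=
  (map_mx (@conjc R) A)^T.

Definition lambda_max n (M : 'M[R[i]]_n) : R :=
  sup [set a : R | eigenvalue M a%:C%C].

Definition lambdaL (d N L : nat) (x : 'I_L -> 'I_d -> R) : R :=
  lambda_max (adjmx (vandermonde N x) *m vandermonde N x).

(* Iterated (nonnegative, extended-real) integral over A^n, given an integral
   functional I on A; a0 is a dummy point used only for n = 0. *)
Definition ocons (A : Type) n (a : A) (y : 'I_n -> A) : 'I_n.+1 -> A :=
  fun i => match unlift ord0 i with Some j => y j | None => a end.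

Fixpoint piter (A : Type) (a0 : A) (I : (A -> \bar R) -> \bar R) (n : nat)
  : (('I_n -> A) -> \bar R) -> \bar R :=
  match n with
  | 0 => fun G => G (fun _ => a0)
  | n'.+1 => fun G => I (fun a => piter a0 I (fun y => G (ocons a y)))
  end.

Definition cube_int (d : nat) (g : ('I_d -> R) -> \bar R) : \bar R :=
  piter (0 : R) (fun h => (\int[@lebesgue_measure R]_(t in `[0%R, 1%R]) h t)%E) g.

Definition in_cube d (x : 'I_d -> R) : Prop := forall j, 0 <= x j <= 1.

Definition iid_prob (d L : nat) (f : 'rV[R]_d -> R)
  (E : set ('I_L -> 'I_d -> R)) : \bar R :=
  piter (fun _ : 'I_d => 0 : R) (@cube_int d)
    (fun x => (\1_E x * \prod_(q < L) f (\row_j x q j))%:E).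

End Vandermonde.

(* Main.v *)
Require Import Defs.
From HB Require Import structures.
From mathcomp Require Import all_boot all_order all_algebra spectral.
From mathcomp Require Import all_classical all_reals all_analysis.
From mathcomp Require Import complex measurable_realfun ring lra.
Set Implicit Arguments. Unset Strict Implicit. Unset Printing Implicit Defensive.
Import Order.TTheory GRing.Theory Num.Theory.
Import numFieldNormedType.Exports.
Local Open Scope classical_set_scope.
Local Open Scope ring_scope.

(** Cut the cube into boxes of side 1/(8dN). If k phase vectors lie in one box,
    then in every row their entries point within an angle pi/4 of each other,
    so the Rayleigh quotient of the indicator of these k columns, hence
    lambda_L, is at least k/2. It remains to find a box holding k phases,
    where k is about log n / (2 log log n) and n = N^d.

    Since f >= c, writing f = c + (f - c) and ignoring the balls drawn from
    f - c leaves a scheme where each ball hits each of the (8dN)^d boxes with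
    the same probability mu = c / (8dN)^d. The loads are negatively associated:
    the probability that no box holds k balls is at most
    P[Bin(L, mu) < k]^((8dN)^d), which follows by induction on L from the
    Weierstrass product inequality. Splitting the balls into k groups of size
    about L/k gives P[Bin(L, mu) >= k] >= (C/k)^k, and n (C/k)^k >= log n / 8.

    The event "lambda_L >= t" is not known to be measurable, and neither are the
    partial integrals of f. The integral of a nonnegative function is a
    supremum over simple functions below it, i.e. a lower integral; only its
    monotonicity, homogeneity, superadditivity and its behaviour under adding
    constants are used, and these pass to iterated integrals. *)

(** * Lower integrals *)

Section LowerIntegral.
Local Open Scope ereal_scope.
Context {R : realType} {dT : measure_display} {T : measurableType dT}.
Variable mu : {measure set T -> \bar R}.
Variable D : set T.
Hypothesis mD : measurable D.
Import HBNNSimple.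

Lemma ge0_le_integral_nomeas (g h : T -> \bar R) :
  (forall x, D x -> 0 <= g x) -> (forall x, D x -> g x <= h x) ->
  \int[mu]_(x in D) g x <= \int[mu]_(x in D) h x.
Proof.
move=> g0 gh; have h0 x : D x -> 0 <= h x.
  by move=> Dx; rewrite (le_trans (g0 _ Dx)) ?gh.
rewrite !ge0_integralE//; apply: ge_ereal_sup => _ [s /= sg <-].
apply: ereal_sup_ubound; exists s => //= x; apply: le_trans (sg x) _.
by rewrite /patch; case: ifPn => // /[!inE] /gh.
Qed.

Lemma le_integral_nnsfun (s : {nnsfun T >-> R}) (g : T -> \bar R) :
  (forall x, D x -> 0 <= g x) -> (forall x, (s x)%:E <= (g \_ D) x) ->
  sintegral mu s <= \int[mu]_(x in D) g x.
Proof.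
by move=> g0 sg; rewrite ge0_integralE//; apply: ereal_sup_ubound; exists s.
Qed.

(** A simple function below [g] plus one below [h] is a simple function below [g + h]. The infinite
    case is split off so that the two suprema can be reached by subtracting finite quantities. *)
Lemma lower_integral_superadd (g h : T -> \bar R) :
  (forall x, D x -> 0 <= g x) -> (forall x, D x -> 0 <= h x) ->
  \int[mu]_(x in D) g x + \int[mu]_(x in D) h x <=
  \int[mu]_(x in D) (g x + h x).
Proof.
move=> g0 h0; have gh0 x : D x -> 0 <= g x + h x.
  by move=> Dx; rewrite adde_ge0 ?g0 ?h0.
have [/eqP->|noo] := boolP (\int[mu]_(x in D) (g x + h x) == +oo).
  by rewrite leey.
have gle : \int[mu]_(x in D) g x <= \int[mu]_(x in D) (g x + h x).
  by apply: ge0_le_integral_nomeas => // x Dx; rewrite leeDl// h0.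
have hle : \int[mu]_(x in D) h x <= \int[mu]_(x in D) (g x + h x).
  by apply: ge0_le_integral_nomeas => // x Dx; rewrite leeDr// g0.
have ghfin : \int[mu]_(x in D) (g x + h x) \is a fin_num.
  by rewrite ge0_fin_numE ?integral_ge0// ltey.
have hfin : \int[mu]_(x in D) h x \is a fin_num.
  rewrite ge0_fin_numE ?integral_ge0//; apply: le_lt_trans hle _.
  by rewrite ltey.
rewrite -leeBrDr// [leLHS]ge0_integralE//.
apply: ge_ereal_sup => _ [s /= sg <-].
have sfin : sintegral mu s \is a fin_num.
  rewrite ge0_fin_numE ?sintegral_ge0//.
  by apply: le_lt_trans (le_trans (le_integral_nnsfun g0 sg) gle) _; rewrite ltey.
rewrite leeBrDr// addeC -leeBrDr// [leLHS]ge0_integralE//.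
apply: ge_ereal_sup => _ [t /= th <-].
rewrite leeBrDr// -sintegralD//.
apply: (@le_integral_nnsfun (add_nnsfun t s)) => // x.
rewrite /= EFinD; apply: le_trans (leeD (th x) (sg x)) _.
by rewrite /patch; case: ifPn => //; rewrite ?adde0// addeC.
Qed.

Lemma lower_integralZl_ge (r : R) (g : T -> \bar R) : (0 < r)%R ->
  (forall x, D x -> 0 <= g x) ->
  r%:E * \int[mu]_(x in D) g x <= \int[mu]_(x in D) (r%:E * g x).
Proof.
move=> r0 g0; rewrite -lee_pdivlMl// [leLHS]ge0_integralE//.
apply: ge_ereal_sup => _ [s /= sg <-]; rewrite lee_pdivlMl//.
rewrite -sintegralrM; apply: (@le_integral_nnsfun (scale_nnsfun s (ltW r0))).
  by move=> x Dx; rewrite mule_ge0 ?lee_fin ?(ltW r0) ?g0.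
move=> x /=; rewrite EFinM; apply: le_trans (lee_pmul _ _ (lexx _) (sg x)) _.
- by rewrite lee_fin ltW.
- by rewrite lee_fin.
- by rewrite /patch; case: ifPn; rewrite ?mule0.
Qed.

(** The missing inequality is [lower_integralZl_ge] for the factor [r^-1] and the function
    [r * g]. *)
Lemma lower_integralZl (r : R) (g : T -> \bar R) : (0 <= r)%R ->
  (forall x, D x -> 0 <= g x) ->
  \int[mu]_(x in D) (r%:E * g x) = r%:E * \int[mu]_(x in D) g x.
Proof.
rewrite le_eqVlt => /predU1P[<-|r0] g0.
  by rewrite mul0e integral0_eq// => x _; rewrite mul0e.
apply/eqP; rewrite eq_le lower_integralZl_ge// andbT.
have rV0 : (0 < r^-1)%R by rewrite invr_gt0.
have := @lower_integralZl_ge r^-1 (fun x => r%:E * g x) rV0.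
rewrite lee_pdivrMl// => /(_ _)/le_trans; apply.
  by move=> x Dx; rewrite mule_ge0 ?lee_fin ?(ltW r0) ?g0.
rewrite lee_pmul2l ?fin_numElt ?ltNyr ?ltry ?lte_fin//.
apply: ge0_le_integral_nomeas => x Dx; rewrite muleA -EFinM mulVf ?gt_eqF// mul1e//.
exact: g0.
Qed.

(** Subadditivity survives when one summand is constant: if [s] is simple and below [r + g], then
    [max (s - r) 0] is measurable, lies below [g], and [s] is at most [r] plus it. *)
Lemma lower_integral_shift (r : R) (g : T -> \bar R) : mu D = 1 -> (0 <= r)%R ->
  (forall x, D x -> 0 <= g x) ->
  \int[mu]_(x in D) (r%:E + g x) <= r%:E + \int[mu]_(x in D) g x.
Proof.
move=> muD r0 g0.
rewrite [leLHS]ge0_integralE; last by move=> x Dx; rewrite adde_ge0 ?lee_fin ?g0.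
apply: ge_ereal_sup => _ [s /= sg <-].
pose k x : R := Num.max (s x - r)%R 0%R.
have mk : measurable_fun D k.
  apply: measurable_maxr => //.
  by apply: measurable_funB => //; apply: measurable_funTS; exact: measurable_funP.
have k0 x : (0 <= k x)%R by rewrite le_max lexx orbT.
(* Off [D] the function [s] vanishes, being nonnegative and below the extension of [r + g] by 0. *)
have -> : sintegral mu s = \int[mu]_(x in D) (s x)%:E.
  rewrite -integralT_nnsfun [RHS]integral_mkcond; apply: eq_integral => x _.
  have := sg x; rewrite /patch; case: ifPn => // _; rewrite lee_fin => sx0.
  by congr EFin; apply/eqP; rewrite eq_le sx0/=.
apply: (@le_trans _ _ (\int[mu]_(x in D) (r%:E + (k x)%:E))).
  apply: ge0_le_integral_nomeas => x Dx; rewrite ?lee_fin//.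
  by rewrite -lerBlDl le_max lexx.
rewrite ge0_integralD//; [|by move=> x _; rewrite lee_fin|exact/measurable_EFinP].
rewrite integral_cst// muD mule1 leeD2l//; apply: ge0_le_integral_nomeas => x Dx.
  by rewrite lee_fin.
rewrite /k maxEle; case: ifPn => _; first exact: g0.
have := sg x; rewrite /patch mem_set//.
by rewrite EFinB leeBlDl.
Qed.

End LowerIntegral.

(** * Lower expectations and their iterates *)

Section LowerExpectation.
Local Open Scope ereal_scope.
Context {R : realType}.

(** These four rules replace integration theory from here on: they hold for the one-variable lower
    integral and are stable under iteration. [lexp_shift] encodes total mass at most 1. *)
Record lower_expectation (A : Type) (D : A -> Prop)
    (I : (A -> \bar R) -> \bar R) : Prop := LowerExpectation {
  lexp_le : forall g h, (forall a, D a -> 0 <= g a) ->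
    (forall a, D a -> g a <= h a) -> I g <= I h ;
  lexpZ : forall (r : R) g, (0 <= r)%R -> (forall a, D a -> 0 <= g a) ->
    I (fun a => r%:E * g a) = r%:E * I g ;
  lexpD : forall g h, (forall a, D a -> 0 <= g a) ->
    (forall a, D a -> 0 <= h a) -> I g + I h <= I (fun a => g a + h a) ;
  lexp_shift : forall (r : R) g, (0 <= r)%R -> (forall a, D a -> 0 <= g a) ->
    I (fun a => r%:E + g a) <= r%:E + I g
}.

Lemma lebesgue_lower_expectation : lower_expectation (fun t : R => (0 <= t <= 1)%R)
  (fun h => \int[@lebesgue_measure R]_(t in `[0%R, 1%R]) h t).
Proof.
have mu1 : @lebesgue_measure R `[0%R, 1%R] = 1.
  by rewrite lebesgue_measure_itv/= lte_fin ltr01 oppr0 adde0.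
have DE (P : R -> Prop) : (forall a, (0 <= a <= 1)%R -> P a) ->
    forall a, `[0%R, 1%R]%classic a -> P a.
  by move=> H a; rewrite /= in_itv/=; exact: H.
split=> *.
- by apply: ge0_le_integral_nomeas => //; exact: DE.
- by apply: lower_integralZl => //; exact: DE.
- by apply: lower_integral_superadd => //; exact: DE.
- by apply: lower_integral_shift => //; exact: DE.
Qed.

Context {A : Type} {D : A -> Prop} {I : (A -> \bar R) -> \bar R}.
Hypothesis lI : lower_expectation D I.

Lemma lexp0 : I (fun=> 0) = 0.
Proof.
have := @lexpZ _ _ _ lI 0%R (fun=> 0) (lexx _) (fun _ _ => lexx _).
by rewrite !mul0e.
Qed.

Lemma lexp_ge0 g : (forall a, D a -> 0 <= g a) -> 0 <= I g.
Proof. by move=> g0; rewrite -lexp0; apply: (lexp_le lI) => // a _; rewrite lexx. Qed.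

Lemma eq_lexp g h : (forall a, D a -> 0 <= g a) -> (forall a, D a -> g a = h a) ->
  I g = I h.
Proof.
move=> g0 gh; apply/eqP; rewrite eq_le.
by apply/andP; split; apply: (lexp_le lI) => a Da; rewrite -?gh//; exact: g0.
Qed.

Lemma lexp_sum (J : Type) (s : seq J) (P : pred J) (g : J -> A -> \bar R) :
  (forall j a, D a -> 0 <= g j a) ->
  \sum_(j <- s | P j) I (g j) <= I (fun a => \sum_(j <- s | P j) g j a).
Proof.
move=> g0; elim: s => [|j s IH].
  by rewrite big_nil; under eq_fun do rewrite big_nil; rewrite lexp0.
have -> : (fun a => \sum_(i <- j :: s | P i) g i a) = (fun a =>
    if P j then g j a + \sum_(i <- s | P i) g i a else \sum_(i <- s | P i) g i a).
  by apply/funext => a; rewrite big_cons.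
rewrite big_cons; case: ifPn => // _; apply: le_trans (leeD2l _ IH) _.
by apply: (lexpD lI) => a Da; rewrite ?g0// sume_ge0// => i _; exact: g0.
Qed.

Lemma ocons_in (n : nat) (P : A -> Prop) (a : A) (y : 'I_n -> A) :
  P a -> (forall i, P (y i)) -> forall i, P (ocons a y i).
Proof. by move=> Pa Py i; rewrite /ocons; case: unliftP. Qed.

(** Each rule for [I] applies to the inner iterate, which is a nonnegative function of the first
    coordinate. The lemma serves twice: for the [d] coordinates of a phase vector and for the [L]
    vectors. *)
Lemma piter_lower_expectation (a0 : A) n :
  lower_expectation (fun y : 'I_n -> A => forall i, D (y i)) (piter a0 I (n := n)).
Proof.
elim: n => [|n [IHle IHZ IHD IHs]].
  split=> /= [g h g0|r g r0 g0|g h g0 h0|r g r0 g0] //.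
  by apply; case.
have ge0 (g : ('I_n -> A) -> \bar R) :
    (forall y, (forall i, D (y i)) -> 0 <= g y) -> 0 <= piter a0 I g.
  move=> g0; have := @IHZ 0%R g (lexx _) g0; rewrite mul0e => <-.
  by apply: IHle => y /g0 gy; rewrite mul0e.
have Do a y : D a -> (forall i, D (y i)) -> forall i, D (@ocons A n a y i).
  exact: ocons_in.
split=> /= [g h g0 gh|r g r0 g0|g h g0 h0|r g r0 g0].
- apply: (lexp_le lI) => a Da; first by apply: ge0 => y Dy; exact: g0 (Do _ _ _ _).
  by apply: IHle => y Dy; [exact: g0 (Do _ _ _ _)|exact: gh (Do _ _ _ _)].
- rewrite -(lexpZ lI)//; last by move=> a Da; apply: ge0 => y Dy; exact: g0 (Do _ _ _ _).
  apply: eq_lexp => a Da.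
    by apply: ge0 => y Dy; rewrite mule_ge0 ?lee_fin//; exact: g0 (Do _ _ _ _).
  by apply: IHZ => // y Dy; exact: g0 (Do _ _ _ _).
- apply: le_trans (lexpD lI _ _) _.
  + by move=> a Da; apply: ge0 => y Dy; exact: g0 (Do _ _ _ _).
  + by move=> a Da; apply: ge0 => y Dy; exact: h0 (Do _ _ _ _).
  + apply: (lexp_le lI) => a Da.
      by apply: adde_ge0; apply: ge0 => y Dy; [exact: g0 (Do _ _ _ _)|exact: h0 (Do _ _ _ _)].
    by apply: IHD => y Dy; [exact: g0 (Do _ _ _ _)|exact: h0 (Do _ _ _ _)].
- apply: le_trans (lexp_shift lI _ _) => //; last first.
    by move=> a Da; apply: ge0 => y Dy; exact: g0 (Do _ _ _ _).
  apply: (lexp_le lI) => a Da.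
    by apply: ge0 => y Dy; rewrite adde_ge0 ?lee_fin//; exact: g0 (Do _ _ _ _).
  by apply: IHs => // y Dy; exact: g0 (Do _ _ _ _).
Qed.

End LowerExpectation.

Lemma cube_int_lower_expectation {R : realType} d :
  lower_expectation (@in_cube R d) (@cube_int R d).
Proof. exact: piter_lower_expectation (lebesgue_lower_expectation) _ _. Qed.

(** * Balls into boxes *)

(** Independence by homogeneity alone: with the first coordinate fixed, its factor is a constant for
    the inner iterate, whose value is then a constant for the outer one. *)
Lemma piter_prod {R : realType} (A : Type) (D : A -> Prop) I (a0 : A) n
    (phi : 'I_n -> A -> R) (v : 'I_n -> R) :
  lower_expectation D I ->
  (forall j a, D a -> 0 <= phi j a) ->
  (forall j, I (fun a => (phi j a)%:E) = (v j)%:E) ->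
  piter a0 I (fun y => (\prod_j phi j (y j))%:E) = (\prod_j v j)%:E.
Proof.
move=> lI; elim: n phi v => [|n IH] phi v phi0 phiv; first by rewrite /= !big_ord0.
have v0 j : 0 <= v j.
  by rewrite -lee_fin -phiv; apply: (lexp_ge0 lI) => a Da; rewrite lee_fin phi0.
rewrite /=.
transitivity (I (fun a => (\prod_(j < n) v (lift ord0 j))%:E * (phi ord0 a)%:E))%E.
  apply: (eq_lexp lI) => a Da.
    apply: (lexp_ge0 (piter_lower_expectation lI a0 n)) => y Dy.
    by rewrite lee_fin prodr_ge0// => j _; apply/phi0/(@ocons_in _ _ D).
  rewrite -(IH (fun j => phi (lift ord0 j)))//; last by move=> j; exact: phi0.
  rewrite muleC -(lexpZ (piter_lower_expectation lI a0 n)) ?phi0//; last first.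
    by move=> y Dy; rewrite lee_fin prodr_ge0// => j _; exact: phi0.
  congr piter; apply/funext => y; rewrite -EFinM big_ord_recl; congr (_ * _)%:E.
    by rewrite /ocons unlift_none.
  by apply: eq_bigr => j _; rewrite /ocons liftK.
rewrite (lexpZ lI) ?prodr_ge0//; last by move=> a Da; rewrite lee_fin phi0.
by rewrite phiv -EFinM big_ord_recl mulrC.
Qed.

(** * Lower tails of the binomial distribution *)

Section Binomial.
Context {R : realType}.
Implicit Types (mu : R) (L k : nat).

(* P[Bin(L, mu) < k], conditioning on the first trial. *)
Fixpoint binom_lt mu L k : R :=
  if L is L'.+1 then mu * binom_lt mu L' k.-1 + (1 - mu) * binom_lt mu L' k
  else (0 < k)%N%:R.

Lemma binom_lt_ge0 mu L k : 0 <= mu <= 1 -> 0 <= binom_lt mu L k.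
Proof.
move=> /andP[mu0 mu1]; elim: L k => [|L IH] k //=.
by rewrite addr_ge0// mulr_ge0// subr_ge0.
Qed.

Lemma binom_lt0 mu L : binom_lt mu L 0 = 0.
Proof. by elim: L => //= L ->; rewrite !mulr0 addr0. Qed.

Lemma binom_lt_pred mu L k : 0 <= mu <= 1 -> binom_lt mu L k.-1 <= binom_lt mu L k.
Proof.
move=> /andP[mu0 mu1]; elim: L k => [|L IH] [|k] //=; first by rewrite ler_nat; case: k.
by rewrite lerD// ler_wpM2l ?subr_ge0//; exact: (IH k.+1).
Qed.

Lemma binom_ltS mu L k : 0 <= mu <= 1 -> binom_lt mu L.+1 k <= binom_lt mu L k.
Proof.
move=> mu01; have := binom_lt_pred L k mu01; case/andP: mu01 => mu0 mu1 /= h.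
by nra.
Qed.

Lemma binom_lt_le mu L L' k : 0 <= mu <= 1 -> (L <= L')%N ->
  binom_lt mu L' k <= binom_lt mu L k.
Proof.
move=> mu01; elim: L' => [|L' IH]; first by rewrite leqn0 => /eqP->.
rewrite leq_eqVlt => /predU1P[->//|]; rewrite ltnS => /IH.
exact/le_trans/binom_ltS.
Qed.

Lemma binom_lt_le1 mu L k : 0 <= mu <= 1 -> binom_lt mu L k <= 1.
Proof.
by move=> mu01; apply: le_trans (binom_lt_le _ mu01 (leq0n L)) _; case: k.
Qed.

(* One success in the first [m] trials and [k] in the remaining ones. *)
Lemma binom_lt_block mu L m k : 0 <= mu <= 1 ->
  1 - binom_lt mu (m + L) k.+1 >= (1 - (1 - mu) ^+ m) * (1 - binom_lt mu L k).
Proof.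
move=> mu01; have /andP[mu0 mu1] := mu01; elim: m => [|m IH].
  rewrite expr0 subrr mul0r subr_ge0; exact: binom_lt_le1.
(* If the first trial succeeds, the other [m + L] trials reach [k] at least as likely as [L] trials
   do; if it fails, the induction hypothesis applies. *)
rewrite addSn /= exprS; have := @binom_lt_le mu L (m + L) k mu01 (leq_addl _ _).
set p := _ ^+ m in IH *; set g := binom_lt _ L k in IH *.
set g1 := binom_lt _ (m + L) k; set g2 := binom_lt _ _ k.+1 in IH *.
by nra.
Qed.

(** It suffices that each of [k] disjoint blocks of [m] trials contains a success. *)
Lemma binom_lt_blocks mu m k : 0 <= mu <= 1 ->
  (1 - (1 - mu) ^+ m) ^+ k <= 1 - binom_lt mu (k * m) k.
Proof.
move=> mu01; have /andP[mu0 mu1] := mu01; elim: k => [|k IH].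
  by rewrite binom_lt0 subr0 expr0.
rewrite mulSn exprS; apply: le_trans (binom_lt_block _ _ _ mu01).
rewrite ler_wpM2l// subr_ge0 exprn_ile1 ?subr_ge0//.
by rewrite lerBlDr lerDl.
Qed.

End Binomial.

(* Equivalently [1 - prod u_b / g_b <= sum_b (1 - u_b / g_b)]: the union bound
   for independent events. *)
Lemma prod_sub_le_sum {R : realFieldType} (B : eqType) (s : seq B) (u g : B -> R) :
  uniq s -> (forall b, 0 <= u b <= g b) ->
  \prod_(b <- s) g b - \prod_(b <- s) u b <=
  \sum_(b <- s) (\prod_(b' <- s) g b' -
                 \prod_(b' <- s) (if b' == b then u b' else g b')).
Proof.
move=> + ug; elim: s => [|c s IH]; first by rewrite !big_nil subrr.
rewrite cons_uniq => /andP[cs /IH {}IH]; rewrite !big_cons eqxx.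
have -> : \prod_(j <- s) (if j == c then u j else g j) = \prod_(j <- s) g j.
  by apply: eq_big_seq => j js; case: eqP => // jc; rewrite -jc js in cs.
set G := \prod_(j <- s) g j in IH *; set U := \prod_(j <- s) u j in IH *.
have UG : U <= G by apply: ler_prod => b _.
have -> : \sum_(b <- s) (g c * G - \prod_(b' <- (c :: s)) (if b' == b then u b' else g b'))
    = g c * \sum_(b <- s) (G - \prod_(b' <- s) (if b' == b then u b' else g b')).
  rewrite mulr_sumr; apply: eq_big_seq => b bs; rewrite big_cons mulrBr.
  by case: eqP => // cb; rewrite cb bs in cs.
set S := \sum_(b <- s) _ in IH *; have /andP[u0 uc] := ug c.
by nra.
Qed.

(** * Occupancy of disjoint boxes *)

Section Occupancy.
Context {R : realType} (B : finType).
Implicit Types (mu : R) (r : B -> nat).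

(* Probability that some box [b] receives at least [r b] of [L] balls if the
   loads were independent; the true probability is at least this. *)
Definition occupancy mu L r : R := 1 - \prod_b binom_lt mu L (r b).

(** The demands left after a ball lands in [b]; truncated subtraction keeps a met demand at 0. *)
Definition hit r (b : B) : B -> nat := fun b' => (r b' - (b' == b))%N.

Lemma occupancy_ge0 mu L r : 0 <= mu <= 1 -> 0 <= occupancy mu L r.
Proof.
move=> mu01; rewrite subr_ge0; apply: prodr_ile1 => b _.
by rewrite binom_lt_ge0// binom_lt_le1.
Qed.

Lemma occupancy_hit mu L r b : 0 <= mu <= 1 ->
  occupancy mu L r <= occupancy mu L (hit r b).
Proof.
move=> mu01; rewrite lerD2l lerN2; apply: ler_prod => b' _.
rewrite binom_lt_ge0//= /hit; case: eqP => _ //=; last by rewrite subn0.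
by rewrite subn1 binom_lt_pred.
Qed.

(** One step of negative association. On the left every box makes its own extra trial; on the right
    a single ball hits each box with weight [mu], excluding the others. The gain on the left is at
    most the sum of the gains of single boxes, by [prod_sub_le_sum]. *)
Lemma occupancyS mu L r : 0 <= mu <= 1 ->
  occupancy mu L.+1 r <=
  \sum_b mu * occupancy mu L (hit r b) + (1 - mu *+ #|B|) * occupancy mu L r.
Proof.
move=> mu01; have /andP[mu0 mu1] := mu01.
pose g b := binom_lt mu L (r b); pose u b := binom_lt mu L.+1 (r b).
have ug b : 0 <= u b <= g b by rewrite binom_lt_ge0// binom_ltS.
have := prod_sub_le_sum (index_enum_uniq B) ug.
(* The recursion of [binom_lt] gives [g b - u b = mu * (g b - binom_lt mu L (r b).-1)]. *)
have H b : \prod_b' g b' - \prod_b' (if b' == b then u b' else g b') =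
    mu * (\prod_b' g b' - \prod_b' binom_lt mu L (hit r b b')).
  rewrite [in LHS](bigD1 b)//= [X in _ - X](bigD1 b)//= eqxx.
  rewrite [in RHS](bigD1 b)//= [X in mu * (_ - X)](bigD1 b)//=.
  rewrite /hit eqxx subn1.
  have -> : \prod_(i | i != b) (if i == b then u i else g i) = \prod_(i | i != b) g i.
    by apply: eq_bigr => i /negbTE->.
  have -> : \prod_(i | i != b) binom_lt mu L (r i - (i == b)) = \prod_(i | i != b) g i.
    by apply: eq_bigr => i /negbTE->; rewrite subn0.
  rewrite /u /g /=; ring.
under [X in _ <= X -> _]eq_bigr do rewrite H.
rewrite /occupancy -/g.
under [X in _ -> _ <= X + _]eq_bigr => b _.
  rewrite (_ : mu * _ = mu * (1 - \prod_b' g b') +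
    mu * (\prod_b' g b' - \prod_b' binom_lt mu L (hit r b b'))); last by ring.
  over.
rewrite big_split/= sumr_const cardT -cardE -mulr_natl => h.
have -> : (1 - mu *+ #|B|) = 1 - #|B|%:R * mu by rewrite mulr_natl.
rewrite -/(u _).
have -> : \prod_b (mu * binom_lt mu L (r b).-1 + (1 - mu) * binom_lt mu L (r b)) =
  \prod_b u b by [].
have -> : \prod_b binom_lt mu L (r b) = \prod_b g b by [].
move: h; set S := \sum_b _; set G := \prod_b g b; set U := \prod_b u b.
set n := #|B|%:R; nra.
Qed.

(** This is [occupancyS] integrated over the position of one ball of density [f]; the constant part
    [c] of the density gives each box mass at least [mu]. *)
Lemma occupancy_mixture (A : Type) (D : A -> Prop) I (f : A -> R)
    (box : B -> A -> bool) (c mu : R) L r :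
  lower_expectation D I -> 0 <= c -> 0 <= mu <= 1 -> mu *+ #|B| = c ->
  (forall a, D a -> c <= f a) -> I (fun a => (f a)%:E) = 1%:E ->
  (forall a b b', box b a -> box b' a -> b = b') ->
  (forall b, (mu%:E <= c%:E * I (fun a => (box b a)%:R%:E))%E) ->
  ((occupancy mu L.+1 r)%:E <=
   I (fun a => (f a * occupancy mu L (fun b => (r b - box b a)%N))%:E))%E.
Proof.
move=> lI c0 mu01 muc cf f1 dis volb; have /andP[mu0 mu1] := mu01.
(* The shift rule for [f = c + (f - c)] stands in for additivity. *)
have fc1 : ((1 - c)%:E <= I (fun a => (f a - c)%:E))%E.
  rewrite EFinB leeBlDr// -f1 addeC.
  apply: le_trans (lexp_shift lI _ _) => //; last first.
    by move=> a Da; rewrite lee_fin subr_ge0 cf.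
  apply: (lexp_le lI) => a Da; first by rewrite lee_fin (le_trans c0) ?cf.
  by rewrite -EFinD lee_fin addrC subrK.
(* A ball drawn from the part [f - c] of the density is ignored. *)
apply: (@le_trans _ _ (\sum_b (occupancy mu L (hit r b))%:E *
      (c%:E * I (fun a => (box b a)%:R%:E)) +
    (occupancy mu L r)%:E * I (fun a => (f a - c)%:E))%E).
  apply: (@le_trans _ _ (\sum_b (occupancy mu L (hit r b))%:E * mu%:E +
    (occupancy mu L r)%:E * (1 - c)%:E)%E).
    rewrite -EFinM.
    under eq_bigr do rewrite -EFinM.
    rewrite sumEFin -EFinD lee_fin (le_trans (occupancyS _ _ mu01))// muc.
    by rewrite mulrC lerD2r; apply: ler_sum => b _; rewrite mulrC.
  apply: leeD; last by rewrite lee_wpmul2l// lee_fin occupancy_ge0.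
  by apply: lee_sum => b _; rewrite lee_wpmul2l// lee_fin occupancy_ge0.
have box0 b a : D a -> (0 <= (box b a)%:R%:E :> \bar R)%E by rewrite lee_fin.
have -> : (\sum_b (occupancy mu L (hit r b))%:E * (c%:E * I (fun a => (box b a)%:R%:E)) =
    \sum_b I (fun a => (occupancy mu L (hit r b) * c)%:E * (box b a)%:R%:E))%E.
  apply: eq_bigr => b _; rewrite muleA -EFinM (lexpZ lI)//.
  by rewrite mulr_ge0 ?occupancy_ge0.
rewrite -(lexpZ lI) ?occupancy_ge0//; last by move=> a Da; rewrite lee_fin subr_ge0 cf.
apply: le_trans (leeD2r _ (lexp_sum lI _ _ _)) _.
  by move=> b a Da; rewrite -EFinM lee_fin !mulr_ge0 ?occupancy_ge0.
apply: le_trans (lexpD lI _ _) _.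
- move=> a Da; apply: sume_ge0 => b _.
  by rewrite -EFinM lee_fin !mulr_ge0 ?occupancy_ge0.
- by move=> a Da; rewrite -EFinM lee_fin mulr_ge0 ?occupancy_ge0// subr_ge0 cf.
apply: (lexp_le lI) => a Da.
  rewrite adde_ge0//; last first.
    by rewrite -EFinM lee_fin mulr_ge0 ?occupancy_ge0// subr_ge0 cf.
  apply: sume_ge0 => b _.
  by rewrite -EFinM lee_fin !mulr_ge0 ?occupancy_ge0.
under eq_bigr do rewrite -EFinM.
rewrite -EFinM sumEFin -EFinD lee_fin.
(* At a point of box [b], [c * o' + (f - c) * o <= f * o'] because a hit only raises occupancy, from
   [o] to [o']. Outside all boxes only [(f - c) * o] remains. *)
have [/existsP[b ba]|/existsPn nob] := boolP [exists b, box b a].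
  have boxE b' : box b' a = (b' == b).
    apply/idP/eqP => [b'a|->//]; exact: dis b'a ba.
  rewrite (bigD1 b)//= big1 ?addr0 => [|b' /negbTE b'b]; last first.
    by rewrite boxE b'b mulr0.
  rewrite ba mulr1.
  have -> : (fun b' => (r b' - box b' a)%N) = hit r b.
    by apply/funext => b'; rewrite boxE.
  have := occupancy_hit L r b mu01; have := cf _ Da.
  by set o := occupancy _ _ _; set o' := occupancy _ _ _; nra.
rewrite big1 ?add0r => [|b _]; last by rewrite (negbTE (nob b)) mulr0.
have -> : (fun b' => (r b' - box b' a)%N) = r.
  by apply/funext => b'; rewrite (negbTE (nob b')) subn0.
by have := occupancy_ge0 L r mu01; set o := occupancy _ _ _; nra.
Qed.

(** Induction on [L], exposing one ball at a time and lowering the demands [r] accordingly. The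
    weight [w] accumulates the density factors of the balls already exposed. *)
Lemma occupancy_le_piter (A : Type) (D : A -> Prop) I (a0 : A) (f : A -> R)
    (box : B -> A -> bool) (c mu : R) L r (w : R) :
  lower_expectation D I -> 0 <= c -> 0 <= mu <= 1 -> mu *+ #|B| = c ->
  (forall a, D a -> c <= f a) -> I (fun a => (f a)%:E) = 1%:E ->
  (forall a b b', box b a -> box b' a -> b = b') ->
  (forall b, (mu%:E <= c%:E * I (fun a => (box b a)%:R%:E))%E) ->
  0 <= w ->
  ((w * occupancy mu L r)%:E <= piter a0 I (fun x : 'I_L -> A =>
    (w * ([exists b, (r b <= \sum_q box b (x q))%N]%:R * \prod_q f (x q)))%:E))%E.
Proof.
move=> lI c0 mu01 muc cf f1 dis volb.
have f0 a : D a -> 0 <= f a by move=> /cf; exact: le_trans.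
elim: L r w => [|L IH] r w w0 /=.
  rewrite lee_fin ler_wpM2l// big_ord0 mulr1.
  rewrite /occupancy lerBlDr; case: existsP => [_|nb] /=.
    by rewrite lerDl prodr_ge0.
  rewrite add0r big1// => b _; rewrite lt0n; case: eqP => // rb0.
  by case: nb; exists b; rewrite rb0.
have lpI := piter_lower_expectation lI a0 L.
apply: (@le_trans _ _ (I (fun a =>
    (w * f a * occupancy mu L (fun b => (r b - box b a)%N))%:E))%E).
  rewrite EFinM; apply: le_trans.
    apply: lee_wpmul2l; first by rewrite lee_fin.
    exact: (@occupancy_mixture A D I f box c mu L r).
  rewrite -(lexpZ lI)//; last first.
    by move=> a Da; rewrite lee_fin mulr_ge0 ?f0 ?occupancy_ge0.
  apply: (lexp_le lI) => a Da.
    by rewrite -EFinM lee_fin mulr_ge0// mulr_ge0 ?f0 ?occupancy_ge0.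
  by rewrite -EFinM mulrA.
apply: (lexp_le lI) => a Da.
  by rewrite lee_fin !mulr_ge0 ?f0 ?occupancy_ge0.
apply: le_trans (IH _ _ _) _; first by rewrite mulr_ge0// f0.
apply: (lexp_le lpI) => y Dy.
  rewrite lee_fin !mulr_ge0 ?f0// prodr_ge0// => q _; exact: f0.
rewrite lee_fin big_ord_recl /=.
have -> : f (ocons a y ord0) = f a by rewrite /ocons unlift_none.
have -> : \prod_(i < L) f (ocons a y (lift ord0 i)) = \prod_(i < L) f (y i).
  by apply: eq_bigr => i _; rewrite /ocons liftK.
have -> : [exists b, (r b <= \sum_q box b (ocons a y q))%N] =
    [exists b, (r b - box b a <= \sum_q box b (y q))%N].
  apply: eq_existsb => b; rewrite leq_subLR big_ord_recl.
  rewrite {1}/ocons unlift_none; congr (_ <= _ + _)%N.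
  by apply: eq_bigr => i _; rewrite /ocons liftK.
rewrite le_eqVlt; apply/orP; left; apply/eqP; ring.
Qed.

End Occupancy.

(** * The largest eigenvalue *)

Section Rayleigh.
Local Open Scope sesquilinear_scope.
Context {C : numClosedFieldType} (n : nat) (M : 'M[C]_n).
Hypothesis hM : M ^t* = M.
Let P := spectralmx M.
Let D := spectral_diag M.

Let hermM : M \is hermsymmx.
Proof. by apply/is_hermitianmxP; rewrite expr0 scale1r. Qed.

Let M_eq : M = P ^t* *m diag_mx D *m P.
Proof.
rewrite -invmx_unitary ?spectral_unitarymx//.
exact/orthomx_spectralP/hermitian_normalmx.
Qed.

Let PPt : P *m P ^t* = 1%:M.
Proof. exact/unitarymxP/spectral_unitarymx. Qed.

Let PtP : P ^t* *m P = 1%:M.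
Proof. exact/mulmx1C/PPt. Qed.

(** Row [i] of the unitary matrix [P] is a left eigenvector. *)
Lemma spectral_diag_eigenvalue i : eigenvalue M (D 0 i).
Proof.
apply/eigenvalueP; exists (row i P).
  rewrite {1}M_eq -row_mul !mulmxA PPt mul1mx.
  by apply/rowP => j; rewrite !mxE; under eq_bigr do rewrite !mxE;
    rewrite (bigD1 i)//= eqxx mulr1n big1 ?addr0// => k /negbTE ki;
    rewrite eq_sym ki mulr0n mul0r.
apply/eqP => /(congr1 (fun u => u *m P ^t*)).
rewrite -row_mul PPt mul0mx => /rowP/(_ i); rewrite !mxE eqxx => /eqP.
by rewrite oner_eq0.
Qed.

Lemma eigenvalue_spectral_diag a : eigenvalue M a -> exists i, a = D 0 i.
Proof.
case/eigenvalueP => v va v0; pose u := v *m P ^t*.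
have uE : u *m diag_mx D = a *: u.
  rewrite /u scalemxAl -va {1}M_eq !mulmxA.
  by rewrite -[RHS]mulmxA PPt mulmx1.
have /rV0Pn[i ui] : u != 0.
  apply: contra_neq v0 => u0.
  by rewrite -[v]mulmx1 -PtP mulmxA -/u u0 mul0mx.
exists i; have /rowP/(_ i) := uE.
by rewrite mul_mx_diag mxE [RHS]mxE mulrC => /(mulIf ui) ->.
Qed.

(** In the eigenbasis the hypothesis says that the sum of [(t - D 0 j) * |u 0 j|^2] is at most 0,
    which fails if every [D 0 j] is below [t]. *)
Lemma rayleigh_le_spectral_diag (t : C) (v : 'rV[C]_n) : t \is Num.real -> v != 0 ->
  t * (v *m v ^t*) 0 0 <= (v *m M *m v ^t*) 0 0 -> exists i, t <= D 0 i.
Proof.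
move=> treal v0; pose u := v *m P ^t*.
have ut : u ^t* = P *m v ^t* by rewrite /u trmx_mul map_mxM trmxCK.
have -> : v *m v ^t* = u *m u ^t*.
  by rewrite ut /u !mulmxA -[v *m _ *m P]mulmxA PtP mulmx1.
have -> : v *m M *m v ^t* = u *m diag_mx D *m u ^t*.
  by rewrite ut /u {1}M_eq !mulmxA.
rewrite mul_mx_diag !mxE.
have uN0 : u != 0.
  apply: contra_neq v0 => u0.
  by rewrite -[v]mulmx1 -PtP mulmxA -/u u0 mul0mx.
have Dreal i : D 0 i \is Num.real.
  by have /mxOverP := hermitian_spectral_diag_real hermM; apply.
move=> le_uu; apply: contrapT => noi.
have Dlt i : D 0 i < t.
  by rewrite real_ltNge//; apply/negP => ti; apply: noi; exists i.
have : \sum_j (t - D 0 j) * (u 0 j * (u 0 j)^*) <= 0.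
  rewrite -subr_ge0 sub0r -sumrN; move: le_uu; rewrite -subr_ge0 mulr_sumr -sumrB.
  congr (0 <= _); apply: eq_bigr => j _; rewrite !mxE; ring.
apply/negP; rewrite -real_ltNge ?rpred0//; last first.
  by apply: rpred_sum => j _; rewrite rpredM ?rpredB// ger0_real// mul_conjC_ge0.
have /rV0Pn[i ui] := uN0.
rewrite (bigD1 i)//= ltr_wpDr//; last by rewrite mulr_gt0 ?subr_gt0// mul_conjC_gt0.
by apply: sumr_ge0 => j _; rewrite mulr_ge0 ?mul_conjC_ge0// subr_ge0 ltW.
Qed.

End Rayleigh.

Section LambdaMax.
Local Open Scope sesquilinear_scope.
Context {R : realType}.

(** Rayleigh quotient of the indicator vector of [S]: its squared norm is [#|S|], and [A] maps it to
    the row sums over [S]. *)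
Lemma lambda_max_ge m n (A : 'M[R[i]]_(m, n)) (S : {set 'I_n}) (t : R) :
  S != finset.set0 ->
  t * #|S|%:R <=
    \sum_r ((complex.Re (\sum_(q in S) A r q)) ^+ 2 +
            (complex.Im (\sum_(q in S) A r q)) ^+ 2) ->
  t <= lambda_max (adjmx A *m A).
Proof.
move=> S0 tS; set M := _ *m A.
have adjE p q (B : 'M[R[i]]_(p, q)) : adjmx B = B ^t*.
  by apply/matrixP => i j; rewrite !mxE.
have hM : M ^t* = M.
  by rewrite /M adjE trmx_mul map_mxM trmxCK.
pose v : 'rV[R[i]]_n := \row_q (q \in S)%:R.
have vt : v ^t* = \col_q (q \in S)%:R.
  by apply/matrixP => i j; rewrite !mxE; case: (_ \in _); rewrite ?conjC1 ?conjC0.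
have vN0 : v != 0.
  have /set0Pn[q qS] := S0; apply/rV0Pn; exists q.
  by rewrite !mxE qS oner_eq0.
have vv : (v *m v ^t*) 0 0 = (#|S|%:R)%:C%C.
  rewrite vt !mxE; under eq_bigr do rewrite !mxE -natrM mulnb andbb.
  by rewrite -natr_sum -sum1_card [in RHS]big_mkcond rmorph_nat; congr _%:R.
have vMv : (v *m M *m v ^t*) 0 0 =
  (\sum_r ((complex.Re (\sum_(q in S) A r q)) ^+ 2 +
           (complex.Im (\sum_(q in S) A r q)) ^+ 2))%:C%C.
  pose w := A *m v ^t*.
  have wt : v *m A ^t* = w ^t* by rewrite /w trmx_mul map_mxM trmxCK.
  rewrite /M adjE !mulmxA wt -mulmxA -/w mxE rmorph_sum; apply: eq_bigr => r _ /=.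
  rewrite add_Re2_Im2 normCKC !mxE.
  have -> : \sum_j A r j * v ^t* j 0 = \sum_(q in S) A r q.
    rewrite vt [RHS]big_mkcond; apply: eq_bigr => q _; rewrite !mxE.
    by case: (q \in S); rewrite ?mulr1 ?mulr0.
  by [].
have treal : t%:C%C \is Num.real by apply/complex_realP; exists t.
have [|i ti] := rayleigh_le_spectral_diag hM treal vN0.
  by rewrite vv vMv -rmorphM lecR.
set D := spectral_diag M in ti *.
have Dr j : D 0 j = (complex.Re (D 0 j))%:C%C.
  rewrite RRe_real//; have hermM : M \is hermsymmx.
    by apply/is_hermitianmxP; rewrite expr0 scale1r.
  by have /mxOverP := hermitian_spectral_diag_real hermM; apply.
rewrite Dr lecR in ti; apply: le_trans ti _.
apply: ub_le_sup; last by rewrite /= -Dr; exact: spectral_diag_eigenvalue.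
(* The supremum defining [lambda_max] dominates its members only once the set of eigenvalues is
   bounded above. *)
exists (\sum_j `|complex.Re (D 0 j)|) => a /= /(eigenvalue_spectral_diag hM)[j].
rewrite -/D Dr => /complexI->; rewrite (bigD1 j)//=.
by apply: le_trans (ler_norm _) _; rewrite lerDl sumr_ge0.
Qed.

End LambdaMax.

(** * Columns with nearly equal phases *)

Section ClosePhases.
Context {R : realType}.

(** Both [cos u] and [cos (2 u) = 2 (cos u)^2 - 1] are nonnegative. *)
Lemma cos_ge_half (u : R) : `|u| <= pi / 4 -> 1 / 2 <= cos u.
Proof.
move=> hu.
have aux (p : R) : 0 < p -> `|u| <= p / 4 ->
    (- (p / 2) <= u <= p / 2) /\ (- (p / 2) <= u *+ 2 <= p / 2).
  rewrite ler_norml [u *+ 2]mulr2n => p0 /andP[u1 u2].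
  by split; apply/andP; split; lra.
have [/cos_ge0_pihalf c0 /cos_ge0_pihalf] := aux _ (pi_gt0 R) hu.
by rewrite cos_mulr2n mulr2n => h; nra.
Qed.

Lemma sqr_sum_cos_sin (I : finType) (S : {set I}) (theta : I -> R) :
  (\sum_(q in S) cos (theta q)) ^+ 2 + (\sum_(q in S) sin (theta q)) ^+ 2 =
  \sum_(q in S) \sum_(q' in S) cos (theta q - theta q').
Proof.
rewrite !expr2 !mulr_suml -big_split; apply: eq_bigr => q _.
rewrite !mulr_sumr -big_split; apply: eq_bigr => q' _.
by rewrite cosB.
Qed.

Lemma sum_sqr_ge_half (I : finType) (S : {set I}) (theta : I -> R) :
  {in S &, forall q q', `|theta q - theta q'| <= pi / 4} ->
  #|S|%:R ^+ 2 / 2 <=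
  (\sum_(q in S) cos (theta q)) ^+ 2 + (\sum_(q in S) sin (theta q)) ^+ 2.
Proof.
move=> close; rewrite sqr_sum_cos_sin.
apply: (@le_trans _ _ (\sum_(q in S) \sum_(q' in S) (1 / 2 : R))).
  by rewrite !sumr_const -mulrnA -[leRHS]mulr_natl natrM expr2 div1r.
apply: ler_sum => q qS; apply: ler_sum => q' q'S.
by apply: cos_ge_half; exact: close.
Qed.

(** Row indices have [d] coordinates below [N], so two phases in [S] differ in any row by at most
    [2 pi d N / (8 d N) = pi / 4]. Each of the [N ^ d] rows then contributes at least
    [N^-d * #|S|^2 / 2]. *)
Lemma lambdaL_ge_half d N L (x : 'I_L -> 'I_d -> R) (S : {set 'I_L}) :
  (0 < N)%N -> S != finset.set0 ->
  {in S &, forall q q' j, (8 * d * N)%:R * `|x q j - x q' j| <= 1} ->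
  #|S|%:R / 2 <= lambdaL N x.
Proof.
move=> N0 S0 close; apply: (lambda_max_ge S0).
pose s r q := \sum_(j < d) (mindex N r j)%:R * x q j.
have sclose r : {in S &, forall q q', `|2 * pi * s r q - 2 * pi * s r q'| <= pi / 4}.
  move=> q q' qS q'S; rewrite -mulrBr normrM gtr0_norm ?mulr_gt0 ?pi_gt0//.
  suff : `|s r q - s r q'| * 8 <= 1.
    move: (pi_gt0 R); move: (pi : R) `|_| => p y; nra.
  rewrite -sumrB; apply: le_trans (ler_wpM2r _ (ler_norm_sum _ _ _)) _ => //.
  rewrite mulr_suml; apply: (@le_trans _ _ (\sum_(j < d) d%:R^-1)).
    apply: ler_sum => j _; have d0 : (0 < d)%N by case: (d) j => // -[].
    rewrite -mulrBr normrM normr_nat -[leRHS]mulr1 ler_pdivlMl ?ltr0n//.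
    apply: le_trans (close q q' qS q'S j).
    have h : (mindex N r j)%:R <= N%:R :> R.
      by rewrite ler_nat ltnW// /mindex ltn_mod.
    rewrite !natrM; have := normr_ge0 (x q j - x q' j).
    have : 0 <= (d%:R : R) by [].
    set y := `|_|; set m := (mindex _ _ _)%:R in h *; move=> dd yy.
    have -> : d%:R * (m * y * 8) = (8 * d%:R * y) * m by ring.
    have -> : 8 * d%:R * N%:R * y = (8 * d%:R * y) * N%:R by ring.
    by rewrite ler_wpM2l// !mulr_ge0.
  rewrite sumr_const card_ord -[leLHS]mulr_natl.
  by case: (posnP d) => [->|d0]; rewrite ?mul0r// divff// pnatr_eq0 -lt0n.
have Nd0 : 0 < (N%:R : R) ^+ d by rewrite exprn_gt0// ltr0n.
apply: (@le_trans _ _ (\sum_(r < N ^ d) (N%:R ^+ d)^-1 * (#|S|%:R ^+ 2 / 2))).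
  rewrite sumr_const card_ord -[leRHS]mulr_natl natrX [leRHS]mulrA divff ?gt_eqF// mul1r.
  by rewrite expr2 mulrAC.
apply: ler_sum => r _.
have aux : \sum_(q in S) vandermonde N x r q =
    (((Num.sqrt (N%:R ^+ d))^-1 * \sum_(q in S) cos (2 * pi * s r q)) +i*
     ((Num.sqrt (N%:R ^+ d))^-1 * \sum_(q in S) sin (2 * pi * s r q)))%C.
  rewrite !mulr_sumr; elim/big_rec3: _ => [//|q a b y _ ->].
  rewrite mxE -/(s r q); apply/eqP; rewrite eq_complex /=.
  by rewrite !mul0r subr0 addr0 !eqxx.
rewrite aux /= !exprMn -mulrDr exprVn sqr_sqrtr; last exact: ltW.
by rewrite ler_wpM2l ?sum_sqr_ge_half// invr_ge0 ltW.
Qed.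

End ClosePhases.

(** * Dividing the cube into boxes *)

Section Boxes.
Context {R : realType}.

(** Half-open sides make distinct boxes disjoint. Points with a coordinate 1 lie in no box, which
    the occupancy bound allows. *)
Definition in_box d M (b : {ffun 'I_d -> 'I_M}) (a : 'I_d -> R) : bool :=
  [forall j, (b j)%:R <= M%:R * a j < (b j).+1%:R].

Lemma in_box_inj d M (a : 'I_d -> R) (b b' : {ffun 'I_d -> 'I_M}) :
  in_box b a -> in_box b' a -> b = b'.
Proof.
move=> /forallP ba /forallP b'a; apply/ffunP => j; apply/val_inj/eqP.
have /andP[h1 h2] := ba j; have /andP[h3 h4] := b'a j.
have lt1 := le_lt_trans h1 h4; have lt2 := le_lt_trans h3 h2.
by rewrite !ltr_nat !ltnS in lt1 lt2; rewrite eqn_leq lt1 lt2.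
Qed.

Lemma in_box_close d M (a a' : 'I_d -> R) (b : {ffun 'I_d -> 'I_M}) j :
  in_box b a -> in_box b a' -> M%:R * `|a j - a' j| <= 1.
Proof.
move=> /forallP/(_ j)/andP[h1 h2] /forallP/(_ j)/andP[h3 h4].
rewrite -[M%:R]normr_nat -normrM mulrBr ler_norml.
rewrite -natr1 in h2; rewrite -natr1 in h4.
by apply/andP; split; lra.
Qed.

Lemma cube_int_in_box d M (b : {ffun 'I_d -> 'I_M}) :
  cube_int (fun a : 'I_d -> R => (in_box b a)%:R%:E) = ((M%:R ^+ d)^-1)%:E.
Proof.
pose phi j (t : R) : R := ((b j)%:R <= M%:R * t < (b j).+1%:R)%R%:R.
transitivity (cube_int (fun a : 'I_d -> R => (\prod_j phi j (a j))%:E)).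
  congr cube_int; apply/funext => a; congr EFin.
  rewrite /in_box; case: forallP => [h|h].
    by rewrite big1// => j _; rewrite /phi h.
  have /existsP[j nj] : [exists j, ~~ ((b j)%:R <= M%:R * a j < (b j).+1%:R)].
    by apply/existsP; apply: contrapT => nex; apply: h => j; apply: contrapT => /negP nj;
      apply: nex; exists j.
  by rewrite (bigD1 j)//= /phi (negbTE nj) mul0r.
rewrite /cube_int (piter_prod _ (v := fun=> M%:R^-1) lebesgue_lower_expectation).
- by rewrite prodr_const card_ord exprVn.
- by move=> j t _; rewrite ler0n.
move=> j; have M0 : 0 < (M%:R : R) by rewrite ltr0n; apply: leq_trans (ltn_ord (b j)).
pose u : R := (b j)%:R / M%:R; pose v : R := (b j).+1%:R / M%:R.
have uv : u < v by rewrite ltr_pM2r ?invr_gt0// ltr_nat.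
have u0 : 0 <= u by rewrite divr_ge0.
have v1 : v <= 1 by rewrite ler_pdivrMr// mul1r ler_nat.
have -> : (fun t => (phi j t)%:E) = (fun t => (\1_(`[u, v[%classic) t)%:E).
  apply/funext => t; congr EFin; rewrite indicE /phi; congr (nat_of_bool _)%:R.
  rewrite mem_setE in_itv/= ler_pdivrMr// ltr_pdivlMr//.
  by rewrite [t * _]mulrC.
rewrite integral_indic//.
have -> : `[u, v[%classic `&` `[0%R, 1%R]%classic = `[u, v[%classic :> set R.
  apply: setIidl => t /=; rewrite !in_itv/= => /andP[ut tv].
  by rewrite (le_trans u0 ut) (le_trans (ltW tv) v1).
apply: etrans (lebesgue_measure_itv `[u, v[) _; rewrite /= lte_fin uv -EFinD; congr EFin.
by rewrite -mulrBl -natr1 addrAC subrr add0r mul1r.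
Qed.

End Boxes.

(** * Probability bounds *)

Section FiniteBounds.
Context {R : realType}.

(** A rational substitute for [(1 - q)^n <= exp (- n q)], used both for a block of trials and for
    the product over boxes. *)
Lemma one_sub_expn_le (q : R) n : 0 <= q <= 1 -> (1 - q) ^+ n * (1 + n%:R * q) <= 1.
Proof.
move=> /andP[q0 q1]; elim: n => [|n IH]; first by rewrite expr0 mul0r addr0 mul1r.
apply: le_trans IH; rewrite exprSr -mulrA ler_wpM2l ?exprn_ge0 ?subr_ge0//.
rewrite -natr1; have : 0 <= n%:R * q by rewrite mulr_ge0.
by nra.
Qed.

Lemma iid_prob_le1 d L (f : 'rV[R]_d -> R) (E : set ('I_L -> 'I_d -> R)) :
  (forall y : 'I_d -> R, in_cube y -> 0 <= f (\row_j y j)) ->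
  cube_int (fun y : 'I_d -> R => (f (\row_j y j))%:E) = 1%E ->
  (iid_prob f E <= 1)%E.
Proof.
move=> f0 f1; have lI := @cube_int_lower_expectation R d.
have := @piter_prod R _ _ _ (fun _ : 'I_d => 0 : R) L
  (fun _ (a : 'I_d -> R) => f (\row_j a j)) (fun=> 1) lI (fun _ => f0) (fun _ => f1).
rewrite big1// => <-.
apply: (lexp_le (piter_lower_expectation lI _ L)) => x Dx.
  by rewrite lee_fin mulr_ge0 ?indicE// prodr_ge0// => q _; exact: f0.
rewrite lee_fin ler_piMl//; first by rewrite prodr_ge0// => q _; exact: f0.
Qed.

Lemma iid_prob_lambdaL_ge d N L (f : 'rV[R]_d -> R) (c mu t : R) k :
  (0 < d)%N -> (0 < N)%N -> (0 < k)%N -> 0 <= c -> 0 <= mu <= 1 ->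
  mu *+ (8 * d * N) ^ d = c -> t <= k%:R / 2 ->
  (forall y : 'I_d -> R, in_cube y -> c <= f (\row_j y j)) ->
  cube_int (fun y : 'I_d -> R => (f (\row_j y j))%:E) = 1%E ->
  ((1 - binom_lt mu L k ^+ ((8 * d * N) ^ d))%:E <=
    iid_prob f [set x : 'I_L -> 'I_d -> R | (t <= lambdaL N x)%R])%E.
Proof.
move=> d0 N0 k0 c0 mu01 muc tk cf f1; set M := (8 * d * N)%N in muc *.
have M0 : (0 < M)%N by rewrite !muln_gt0 d0 N0.
have cardB : #|{ffun 'I_d -> 'I_M}| = (M ^ d)%N by rewrite card_ffun !card_ord.
have lI := @cube_int_lower_expectation R d.
have f0 y : in_cube y -> 0 <= f (\row_j y j) by move=> /cf; exact: le_trans.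
have := @occupancy_le_piter R {ffun 'I_d -> 'I_M} _ _ _ (fun _ : 'I_d => 0 : R)
  (fun a => f (\row_j a j)) (@in_box R d M) c mu L (fun=> k) 1 lI c0 mu01.
rewrite cardB => /(_ muc cf f1).
rewrite mul1r /occupancy prodr_const cardT -cardE cardB => H.
apply: le_trans (H _ _ ler01) _.
- by move=> a b b'; exact: in_box_inj.
- move=> b; rewrite cube_int_in_box -EFinM lee_fin -muc -[mu *+ _]mulr_natr natrX.
  by rewrite mulfK// expf_eq0 pnatr_eq0 -[M == 0]negbK -lt0n M0 andbF.
apply: (lexp_le (piter_lower_expectation lI _ L)) => x Dx.
  by rewrite lee_fin mul1r mulr_ge0// prodr_ge0// => q _; exact: f0.
rewrite lee_fin mul1r ler_wpM2r//; first by rewrite prodr_ge0// => q _; exact: f0.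
case: existsP => [[b kb]|_]; last by rewrite indicE.
rewrite indicE mem_set//=; apply: le_trans tk _.
pose S := [set q | in_box b (x q)]%SET.
have kS : (k <= #|S|)%N.
  rewrite -sum1_card big_mkcond/=; apply: leq_trans kb _.
  by apply: leq_sum => q _; rewrite inE; case: in_box.
apply: (@le_trans _ _ (#|S|%:R / 2)).
  by rewrite ler_wpM2r// ler_nat.
apply: lambdaL_ge_half => //.
  by rewrite -card_gt0 (leq_trans k0).
by move=> q q'; rewrite !inE => qb q'b j; exact: in_box_close qb q'b.
Qed.

(** A block of [m] trials has a success with probability at least [y / (1 + y) >= z / 2], where
    [y = m * mu]. Hence [q = (z / 2)^k] bounds the upper tail from below, and
    [(1 - q)^n <= 1 / (n q)]. *)
Lemma binom_lt_expn_le (mu z : R) m k L n : 0 <= mu <= 1 -> 0 < z <= 1 ->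
  z <= m%:R * mu -> (k * m <= L)%N -> (0 < n)%N ->
  binom_lt mu L k ^+ n <= (n%:R * (z / 2) ^+ k)^-1.
Proof.
move=> mu01 /andP[z0 z1] zm kmL n0; have /andP[mu0 mu1] := mu01.
set q := (z / 2) ^+ k; have q0 : 0 < q by rewrite exprn_gt0// divr_gt0.
have w2 : z / 2 <= 1 - (1 - mu) ^+ m.
  have := one_sub_expn_le m mu01.
  have : 0 <= (1 - mu) ^+ m by rewrite exprn_ge0// subr_ge0.
  set p := (_ ^+ m); set y := m%:R * mu in zm *; nra.
have gq : binom_lt mu L k <= 1 - q.
  apply: le_trans (binom_lt_le _ mu01 kmL) _.
  have := binom_lt_blocks m k mu01.
  have : q <= (1 - (1 - mu) ^+ m) ^+ k.
    by rewrite lerXn2r ?nnegrE ?divr_ge0 ?(ltW z0)// (le_trans _ w2)// divr_ge0// ltW.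
  set a := binom_lt _ _ _; set b := (_ ^+ k); lra.
have g0 := binom_lt_ge0 L k mu01.
have q1 : q <= 1 by lra.
apply: (@le_trans _ _ ((1 - q) ^+ n)).
  by rewrite lerXn2r ?nnegrE// subr_ge0.
have nq0 : 0 < n%:R * q by rewrite mulr_gt0 ?ltr0n.
rewrite -[leRHS]mul1r ler_pdivlMr//.
have := @one_sub_expn_le q n; rewrite (ltW q0) q1 => /(_ isT); apply: le_trans.
by rewrite ler_wpM2l ?exprn_ge0 ?subr_ge0// lerDr.
Qed.

End FiniteBounds.

(** * Choice of [k] and of the constants *)

Section Asymptotics.
Context {R : realType}.

(** From [k <= C x] comes [(C / k)^k >= x^-k], and [k y <= x / 2 + y] gives
    [x^k <= exp (x / 2) * x]. As [n = exp x], the product is at least [exp (x / 2) / x], and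
    [exp (x / 2) >= x^2 / 8]. *)
Lemma log_ratio_growth (C n : R) : 0 < C -> 0 < n ->
  let x := ln n in let y := ln x in let k := (Num.truncn (x / (2 * y))).+1 in
  0 < x -> 0 < y -> C^-1 <= y -> 2 / C <= x ->
  k%:R <= C * x /\ x / 8 <= n * (C / k%:R) ^+ k.
Proof.
move=> C0 n0 x y k x0 y0 Cy Cx.
have xy0 : 0 <= x / (2 * y) by rewrite divr_ge0 ?ltW// mulr_gt0.
have kle : k%:R <= x / (2 * y) + 1.
  have -> : k%:R = (Num.truncn (x / (2 * y)))%:R + 1 :> R by rewrite natr1.
  by rewrite lerD2r; case/andP: (truncn_itv xy0).
have yV : y^-1 <= C by rewrite -[leRHS]invrK lef_pV2 ?posrE ?invr_gt0.
have k0 : 0 < (k%:R : R) by rewrite ltr0n.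
(* Each of [x / (2 y)] and 1 is at most [C x / 2]. *)
have kC : k%:R <= C * x.
  apply: le_trans kle _; rewrite invfM.
  have : 1 <= C * x / 2 by move: Cx; rewrite ler_pdivrMr//; lra.
  by move: (y^-1) yV => w yV; nra.
split=> //.
have xk : x ^+ k <= expR (x / 2) * x.
  rewrite -{1}[x]lnK ?posrE// -expRM_natl -{3}[x]lnK ?posrE// -expRD ler_expR -/y.
  apply: le_trans (ler_wpM2r (ltW y0) kle) _; rewrite mulrDl mul1r lerD2r.
  by have -> : x / (2 * y) * y = x / 2 by field; rewrite gt_eqF.
have Ck : x ^- k <= (C / k%:R) ^+ k.
  rewrite -exprVn lerXn2r ?nnegrE ?invr_ge0 ?divr_ge0 ?(ltW x0) ?(ltW C0)//.
  by rewrite ler_pdivlMr// mulrC ler_pdivrMr.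
have nE : n = expR (x / 2) * expR (x / 2).
  by rewrite -expRD -splitr lnK ?posrE.
apply: le_trans (ler_wpM2l (ltW n0) Ck).
rewrite ler_pdivlMr ?exprn_gt0//.
apply: le_trans (ler_wpM2l _ xk) _; first by rewrite divr_ge0// ltW.
rewrite nE [_ * x]mulrC mulrA ler_wpM2r ?expR_ge0//.
apply: le_trans (@expR_ge1Dxn R (x / 2) 1 (divr_ge0 (ltW x0) (ler0n _ 2))).
have -> : x / 8 * x = (x / 2) ^+ 2 / 2 by field.
by rewrite lerDr.
Qed.

Lemma iid_prob_lambdaL_ge_asymptotic d (f : 'rV[R]_d -> R) (beta c : R) :
  (0 < d)%N -> 0 < beta -> 0 < c <= 1 ->
  (forall y : 'I_d -> R, in_cube y -> c <= f (\row_j y j)) ->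
  cube_int (fun y : 'I_d -> R => (f (\row_j y j))%:E) = 1%E ->
  exists2 A : R, 0 < A & forall N L,
  let x : R := ln (N ^ d)%:R in let y := ln x in
  (0 < N)%N -> A <= x -> A <= y -> beta / 2 * (N%:R ^+ d) <= L%:R ->
  ((1 - 8 / x)%:E <= iid_prob f
      [set x0 : 'I_L -> 'I_d -> R | (1 / 4 * (x / y) <= lambdaL N x0)%R])%E.
Proof.
move=> d0 beta0 /andP[c0 c1] cf f1.
pose D : R := (8 * d)%:R ^+ d; have D1 : 1 <= D.
  by rewrite exprn_ege1// ler1n muln_gt0.
have D0 : 0 < D by exact: lt_le_trans D1.
(* With [mu = c / (D n)], [L >= beta n / 2] and blocks of length [m >= L / (2 k)], one gets
   [m mu >= C2 / k]. The cap at 1 keeps [C2 / k] in the range required of [z]. *)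
pose C2 : R := Num.min (beta * (c / D) / 4) 1.
have C20 : 0 < C2.
  by rewrite lt_min ltr01 andbT divr_gt0// mulr_gt0// divr_gt0.
have C21 : C2 <= 1 by rewrite ge_min lexx orbT.
have C2b : C2 <= beta * (c / D) / 4 by rewrite ge_min lexx.
have cD1 : c / D <= 1 by rewrite ler_pdivrMr// mul1r (le_trans c1).
pose C := C2 / 2; have C0 : 0 < C by rewrite divr_gt0.
have C1 : 1 <= C^-1 by rewrite -[leLHS]invr1 lef_pV2 ?posrE ?/C //; lra.
exists (2 / C); first by rewrite divr_gt0.
move=> N L x y N0 Ax Ay bL.
have C2A : C^-1 <= 2 / C by lra.
have x0 : 0 < x by apply: lt_le_trans Ax; rewrite divr_gt0.
have y0 : 0 < y by apply: lt_le_trans Ay; rewrite divr_gt0.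
set n : R := (N ^ d)%:R in x x0 y y0 Ax Ay *.
have nE : n = N%:R ^+ d by rewrite /n natrX.
have n0 : 0 < n by rewrite ltr0n expn_gt0 N0.
have xn : x <= n.
  have := expR_ge1Dx x; rewrite lnK ?posrE//; lra.
pose k := (Num.truncn (x / (2 * y))).+1.
have [kC growth] := log_ratio_growth C0 n0 x0 y0 (le_trans C2A Ay) Ax.
rewrite -/x -/y -/k in kC growth.
have k0 : 0 < (k%:R : R) by rewrite ltr0n.
have k1 : 1 <= (k%:R : R) by rewrite ler1n.
rewrite -nE in bL.
(* This makes the blocks nonempty, so rounding [L / k] down loses at most a factor 2. *)
have kL : (k <= L)%N.
  rewrite -(ler_nat R); apply: le_trans bL; apply: le_trans kC _.
  apply: (@le_trans _ _ (C * n)); first by rewrite ler_wpM2l// ltW.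
  rewrite ler_wpM2r ?(ltW n0)// /C.
  have bcD : beta * (c / D) <= beta by rewrite ler_piMr// ltW.
  rewrite ler_pM2r ?invr_gt0//; apply: le_trans C2b _.
  by move: (beta * _) bcD beta0; clear; move=> e eb b0; lra.
pose B := ((8 * d * N) ^ d)%N.
have BE : B%:R = D * n by rewrite /B natrX natrM exprMn nE.
pose mu : R := c / B%:R.
have B0 : 0 < (B%:R : R) by rewrite BE mulr_gt0.
have muE : mu = (c / D) / n by rewrite /mu BE invfM mulrA.
have mu0 : 0 <= mu by rewrite divr_ge0// ltW.
have B1 : 1 <= (B%:R : R) by rewrite ler1n -(ltr0n R).
have mu01 : 0 <= mu <= 1 by rewrite mu0 ler_pdivrMr// mul1r (le_trans c1).
pose m := (L %/ k)%N.
have m0 : (0 < m)%N by rewrite divn_gt0.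
have zm : C2 / k%:R <= m%:R * mu.
  have Lm : L%:R <= 2 * m%:R * k%:R :> R.
    rewrite -!natrM ler_nat; have := ltn_ceil L (ltn0Sn (Num.truncn (x / (2 * y)))).
    rewrite -/k -/m => /ltnW/leq_trans; apply.
    by rewrite leq_mul2r mul2n -addnn -addn1 leq_add2l m0 orbT.
  rewrite ler_pdivrMr//; apply: le_trans C2b _.
  have -> : m%:R * mu * k%:R = (2 * m%:R * k%:R) * ((c / D) / (2 * n)).
    by rewrite muE; field; rewrite !gt_eqF.
  apply: (@le_trans _ _ (beta / 2 * n * ((c / D) / (2 * n)))).
    by rewrite le_eqVlt; apply/orP; left; apply/eqP; field; rewrite !gt_eqF.
  by rewrite ler_wpM2r ?(le_trans bL)// !divr_ge0 ?mulr_ge0 ?(ltW c0) ?(ltW D0) ?(ltW n0).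
have z1 : 0 < C2 / k%:R <= 1.
  by rewrite divr_gt0//= ler_pdivrMr// mul1r (le_trans C21).
have tk : 1 / 4 * (x / y) <= k%:R / 2.
  have -> : 1 / 4 * (x / y) = x / (2 * y) / 2 by field; rewrite gt_eqF.
  by rewrite ler_pM2r ?invr_gt0// ltW// truncnS_gt.
have muB : mu *+ (8 * d * N) ^ d = c.
  by rewrite -[LHS]mulr_natr mulfVK// gt_eqF.
have := iid_prob_lambdaL_ge L d0 N0 (ltn0Sn _) (ltW c0) mu01 muB tk cf f1.
apply: le_trans; rewrite lee_fin lerD2l lerN2.
have BN : (0 < (8 * d * N) ^ d)%N by rewrite -(ltr0n R).
apply: le_trans (binom_lt_expn_le mu01 z1 zm _ BN) _.
  by rewrite mulnC leq_divM.
have -> : C2 / k%:R / 2 = C / k%:R by rewrite /C mulrAC.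
rewrite -[leRHS]invf_div lef_pV2 ?posrE ?divr_gt0 ?mulr_gt0 ?exprn_gt0 ?divr_gt0//.
apply: le_trans growth _; rewrite -/B BE -mulrA ler_peMl//.
by rewrite mulr_ge0 ?exprn_ge0 ?divr_ge0 ?ltW.
Qed.

End Asymptotics.

Lemma ln_expn_cvgy {R : realType} d (N : nat -> nat) : (0 < d)%N ->
  (fun n => (N n)%:R : R) @ \oo --> +oo ->
  (fun n => ln (N n ^ d)%:R : R) @ \oo --> +oo.
Proof.
move=> d0 Ny; apply/cvgryPge => A.
have /cvgryPge/(_ (expR A)) := Ny; apply: filterS => n An.
have Nd : (N n)%:R <= (N n ^ d)%:R :> R.
  rewrite ler_nat; case: (posnP (N n)) => [->//|N0].
  by rewrite -{1}[N n]expn1 leq_pexp2l.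
have An' := le_trans An Nd.
rewrite -[A]expRK ler_ln ?posrE ?expR_gt0//.
exact: lt_le_trans (expR_gt0 _) An'.
Qed.

Unset Implicit Arguments. Set Strict Implicit.

Theorem mainTheorem6 (R : realType) (d : nat) (f : 'rV[R]_d -> R) (beta : R)
  (N L : nat -> nat) :
  (1 <= d)%N ->
  (* f is a continuous probability density on [0,1]^d with positive minimum *)
  {within [set v : 'rV[R]_d | forall j, 0 <= v ord0 j <= 1], continuous f} ->
  (exists2 c : R, 0 < c & forall v : 'rV[R]_d,
      (forall j, 0 <= v ord0 j <= 1) -> c <= f v) ->
  cube_int (fun y : 'I_d -> R => (f (\row_j y j))%:E) = 1%E ->
  (* asymptotic regime N, L -> oo, L / N^d -> beta in (0, oo) *)
  0 < beta ->
  (fun n => (N n)%:R : R) @ \oo --> +oo ->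
  (fun n => (L n)%:R : R) @ \oo --> +oo ->
  (fun n => ((L n)%:R / ((N n)%:R ^+ d) : R)) @ \oo --> beta ->
  exists2 K : R, 0 < K &
    (fun n => iid_prob f
       [set x : 'I_(L n) -> 'I_d -> R |
          K * (ln (((N n) ^ d)%:R : R) / ln (ln (((N n) ^ d)%:R : R)))
            <= lambdaL (N n) x]) @ \oo --> 1%E.
Proof.
move=> d0 _ [c0 c00 fc0] f1 beta0 Ny _ LN.
(* The cap at 1 ensures that the hitting probability [mu] of a box is at most 1. *)
pose c := Num.min c0 1.
have c01 : 0 < c <= 1 by rewrite lt_min c00 ltr01 ge_min lexx orbT.
have cf (y : 'I_d -> R) : in_cube y -> c <= f (\row_j y j).
  move=> yD; apply: le_trans (fc0 _ _); first by rewrite ge_min lexx.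
  by move=> j; rewrite mxE.
have [A A0 H] := iid_prob_lambdaL_ge_asymptotic d0 beta0 c01 cf f1.
have xy := ln_expn_cvgy d0 Ny; set x := (fun n => _) in xy.
have x0 : \forall n \near \oo, 0 < x n by move/cvgryPgt: xy => /(_ 0).
(* The eigenvalue is at least [k / 2] with [k > x / (2 ln x)], whence 1/4. *)
exists (1 / 4) => //.
apply: (@squeeze_cvge _ _ _ _ (fun n => (1 - 8 / x n)%:E) _ (fun=> 1%E)).
- near=> n; apply/andP; split; last first.
    apply: iid_prob_le1 => // y /cf; apply: le_trans.
    by case/andP: c01 => /ltW.
  have N0 : (0 < N n)%N.
    have : (1 : R) <= (N n)%:R by near: n; move/cvgryPge: Ny => /(_ 1).
    by rewrite ler1n.
  apply: H => //.
  + by near: n; move/cvgryPge: xy => /(_ A).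
  + have Ax : expR A <= x n by near: n; move/cvgryPge: xy => /(_ (expR A)).
    rewrite -[A]expRK ler_ln ?posrE ?expR_gt0//.
    exact: lt_le_trans (expR_gt0 _) Ax.
  + rewrite -ler_pdivlMr ?exprn_gt0 ?ltr0n//.
    near: n; apply: (@cvgr_ge _ _ _ _ _ beta LN).
    by rewrite ltr_pdivrMr// ltr_pMr// ltr1n.
- apply: cvg_EFin; first by near=> n.
  have xV : (fun n => (x n)^-1) @ \oo --> (0 : R) by apply/gtr0_cvgV0.
  rewrite -[X in _ --> X]subr0 -[X in _ - X](mulr0 8).
  by apply: cvgB; [exact: cvg_cst|apply: cvgM => //; exact: cvg_cst].
- exact: cvg_cst.
Unshelve. all: by end_near. Qed.
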